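(* Let $\kappa$ be a nonzero real constant and consider the Monge–Ampère equation for $G=G(\mathcal{T},\mathfrak{f})$ (subscripts denote partial derivatives) $$4\mathcal{T}^3G_{\mathcal{T}}\Big\{\left(G_{\mathfrak{f}}+\mathfrak{f}\,G_{\mathfrak{f}\mathfrak{f}}\right)\left[(\mathcal{T}^2+8\mathcal{T}-16)G_{\mathcal{T}}+\mathcal{T}(\mathcal{T}^2-16)G_{\mathcal{T}\mathcal{T}}\right]-\mathfrak{f}\,\mathcal{T}(\mathcal{T}^2-16)\,G_{\mathcal{T}\mathfrak{f}}^2\Big\}=-\kappa\,(\mathcal{T}+4)^4 .$$ Let $G_0(\mathcal{T})$ be any smooth real function on an open subinterval of $(0,4)$ such that both $G_0'$ and $(\mathcal{T}^2+8\mathcal{T}-16)G_0'+\mathcal{T}(\mathcal{T}^2-16)G_0''$ are nowhere zero there. Then there exists a unique sequence of smooth functions $G_n(\mathcal{T})$, $n\ge1$, such that $$G(\mathcal{T},\mathfrak{f})=G_0(\mathcal{T})+\sum_{n=1}^\infty G_n(\mathcal{T})\,\mathfrak{f}^n$$ is a formal power series solution in $\mathfrak{f}$ of the equation; that is, $G_0$ is left undetermined by the equation, while each $G_n$, $n\ge1$, is iteratively determined by the functions $G_k$ with $k<n$.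
   Context: The equation expresses the condition that the determinant of the metric $g_{ij^\star}=\partial_i\partial_{j^\star}G$ in complex coordinates $(u,v,w)$ be constant (hence that the metric be Ricci-flat), for a Kähler potential depending only on the invariants $\mathfrak{f}=|w|^2$ and $\mathcal{T}=4+\varpi-\sqrt{\varpi(\varpi+8)}$, $\varpi=(1+|u|^2)^2|v|^2$. Here $G_0$ is the Kähler potential of the metric on the exceptional divisor $w=0$. *)

(* Defs.v *)
From Stdlib Require Import Reals.
From Coquelicot Require Import Coquelicot.

Open Scope R_scope.

(* Functions on the open interval (a, b) are represented by functions R -> R of
   which only the restriction to (a, b) matters; since the interval is open, the
   derivatives at its points depend only on that restriction. *)
Definition smooth_on (a b : R) (g : R -> R) : Prop :=
  forall (k : nat) (T : R), a < T < b -> ex_derive_n g k T.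

Definition eq_on (a b : R) (g h : R -> R) : Prop :=
  forall T : R, a < T < b -> g T = h T.

(* A formal power series sum_n G_n(T) f^n is given by G : nat -> R -> R.
   [fps_dT G j T] is the coefficient sequence, at the point T, of its j-th
   derivative in T, taken coefficientwise. *)
Definition fps_dT (G : nat -> R -> R) (j : nat) (T : R) : nat -> R :=
  fun n => Derive_n (G n) j T.

Definition fps_const (c : R) : nat -> R :=
  fun n => match n with O => c | S _ => 0 end.

(* Formal series in f at a fixed T: PS_mult is the Cauchy product, PS_derive is
   the formal derivative in f, and PS_incr_1 is multiplication by f. *)
Definition MA_lhs (G : nat -> R -> R) (T : R) : nat -> R :=
  let G_T : nat -> R := fps_dT G 1 T in
  let G_TT : nat -> R := fps_dT G 2 T in
  let G_f : nat -> R := PS_derive (fps_dT G 0 T) in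
  let G_ff : nat -> R := PS_derive G_f in
  let G_Tf : nat -> R := PS_derive G_T in
  PS_scal (4 * T ^ 3)
    (PS_mult G_T
      (PS_minus
        (PS_mult
          (PS_plus G_f (PS_incr_1 G_ff))
          (PS_plus (PS_scal (T ^ 2 + 8 * T - 16) G_T)
                   (PS_scal (T * (T ^ 2 - 16)) G_TT)))
        (PS_scal (T * (T ^ 2 - 16)) (PS_incr_1 (PS_mult G_Tf G_Tf))))).

Definition MA_rhs (kappa T : R) : nat -> R :=
  fps_const (- kappa * (T + 4) ^ 4).

Definition MA_order (kappa a b : R) (G : nat -> R -> R) (n : nat) : Prop :=
  forall T : R, a < T < b -> MA_lhs G T n = MA_rhs kappa T n.

Definition smooth_series_from
    (a b : R) (G0 : R -> R) (G : nat -> R -> R) : Prop :=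
  eq_on a b (G O) G0 /\ forall n : nat, smooth_on a b (G n).

Definition formal_solution
    (kappa a b : R) (G0 : R -> R) (G : nat -> R -> R) : Prop :=
  smooth_series_from a b G0 G /\ forall n : nat, MA_order kappa a b G n.

(* Main.v *)
Require Import Defs.
From Stdlib Require Import Reals Lra Lia.
From Coquelicot Require Import Coquelicot.

Open Scope R_scope.

(** The equation is triangular in the coefficients.  In its order-[n] part the
    coefficient [G_(n+1)] occurs only through [G_f + f G_ff], whose [n]-th
    coefficient is [(n+1)^2 G_(n+1)], and there it is multiplied by the order-0
    parts of the two other factors.  So the order-[n] part is an affine function
    of the value [G_(n+1)(T)], without derivatives of [G_(n+1)], and its slope is
    [4 T^3 (n+1)^2 G_0' ((T^2 + 8 T - 16) G_0' + T (T^2 - 16) G_0'')]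
    ([MA_lhs_diff]), which vanishes nowhere because [T > 0] and by the two
    hypotheses on [G_0].

    An affine equation is solved exactly by one Newton step from any starting
    point: if [F] has the prescribed terms up to index [n], the term of index
    [n+1] has to be [F_(n+1)] plus the residual of [F] at order [n] divided by the
    slope ([next_term], [MA_order_iff_next_term]).  This avoids writing out the
    part of the equation that depends on the lower terms.  The new term is smooth,
    being obtained from smooth functions by sums, products, derivatives and one
    division.  Iterating the step gives the solution, and comparing an arbitrary
    solution with it term by term gives uniqueness. *)

(** * Smooth functions on an interval *)

Lemma locally_in_interval (a b T : R) (P : R -> Prop) :
  a < T < b -> (forall t, a < t < b -> P t) -> locally T P.
Proof.
  intros [H1 H2] HP.
  apply (locally_interval P T a b); simpl; auto.
Qed.

Lemma eq_on_ex_derive (a b : R) (g h : R -> R) :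
  eq_on a b g h ->
  (forall T, a < T < b -> ex_derive h T) ->
  forall T, a < T < b -> ex_derive g T.
Proof.
  intros E D T HT.
  apply (ex_derive_ext_loc h); [|now apply D].
  apply (locally_in_interval a b); auto.
  intros t Ht; symmetry; now apply E.
Qed.

Lemma eq_on_Derive (a b : R) (g h : R -> R) :
  eq_on a b g h -> eq_on a b (Derive g) (Derive h).
Proof.
  intros E T HT.
  apply Derive_ext_loc, (locally_in_interval a b); auto.
Qed.

Lemma eq_on_Derive_n (a b : R) (g h : R -> R) (j : nat) :
  eq_on a b g h -> eq_on a b (Derive_n g j) (Derive_n h j).
Proof.
  intros E T HT.
  apply Derive_n_ext_loc, (locally_in_interval a b); auto.
Qed.

Lemma smooth_on_derivable (a b : R) (g : R -> R) :
  smooth_on a b g -> forall T, a < T < b -> ex_derive g T.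
Proof. intros S T HT; exact (S 1%nat T HT). Qed.

Lemma smooth_on_Derive_n (a b : R) (g : R -> R) (j : nat) :
  smooth_on a b g -> smooth_on a b (Derive_n g j).
Proof.
  intros S [|k] T HT; simpl; auto.
  apply (ex_derive_ext (Derive_n g (k + j))).
  - intros t; symmetry; apply Derive_n_comp.
  - exact (S (Datatypes.S (k + j)) T HT).
Qed.

(** The rational expressions in smooth functions.  The derivative of a product
    or of an inverse mixes several operations, so the products alone, or the
    inverses alone, are not stable under derivation; the whole class is, and this
    gives smoothness for all the operations by one induction on the order. *)
Inductive smooth_expr (a b : R) : (R -> R) -> Prop :=
  | smooth_expr_base g : smooth_on a b g -> smooth_expr a b g
  | smooth_expr_plus g h : smooth_expr a b g -> smooth_expr a b h ->
      smooth_expr a b (fun T => g T + h T)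
  | smooth_expr_mult g h : smooth_expr a b g -> smooth_expr a b h ->
      smooth_expr a b (fun T => g T * h T)
  | smooth_expr_inv g : smooth_expr a b g ->
      (forall T, a < T < b -> g T <> 0) ->
      smooth_expr a b (fun T => / g T).

Lemma smooth_on_const (a b c : R) : smooth_on a b (fun _ => c).
Proof. intros k T _; apply ex_derive_n_const. Qed.

Lemma smooth_expr_derive (a b : R) (g : R -> R) :
  smooth_expr a b g ->
  (forall T, a < T < b -> ex_derive g T) /\
  exists h, smooth_expr a b h /\ eq_on a b (Derive g) h.
Proof.
  induction 1 as [g Sg | g h Sg [Dg [g' [Sg' Eg]]] Sh [Dh [h' [Sh' Eh]]]
                 | g h Sg [Dg [g' [Sg' Eg]]] Sh [Dh [h' [Sh' Eh]]]
                 | g Sg [Dg [g' [Sg' Eg]]] Ng].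
  - split; [now apply smooth_on_derivable|].
    exists (Derive g); split; [|now intros T HT].
    now apply smooth_expr_base, (smooth_on_Derive_n a b g 1).
  - split.
    + intros T HT; apply @ex_derive_plus; auto.
    + exists (fun T => g' T + h' T); split; [now constructor|].
      intros T HT; rewrite Derive_plus, Eg, Eh; auto.
  - split.
    + intros T HT; apply ex_derive_mult; auto.
    + exists (fun T => g' T * h T + g T * h' T); split.
      * constructor; now constructor.
      * intros T HT; rewrite Derive_mult, Eg, Eh; auto.
  - split.
    + intros T HT; apply ex_derive_inv; auto.
    + exists (fun T => (-1) * (g' T * (/ g T * / g T))); split.
      * apply (smooth_expr_mult a b (fun _ => -1)).
        { apply smooth_expr_base, smooth_on_const. }
        apply (smooth_expr_mult a b g' (fun T => / g T * / g T)); auto.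
        apply (smooth_expr_mult a b (fun T => / g T) (fun T => / g T));
          now constructor.
      * intros T HT; rewrite Derive_inv, Eg; auto; field; auto.
Qed.

Lemma smooth_expr_smooth (a b : R) (g : R -> R) :
  smooth_expr a b g -> smooth_on a b g.
Proof.
  intros Sg.
  assert (N : forall k, exists h,
             smooth_expr a b h /\ eq_on a b (Derive_n g k) h).
  { induction k as [|k [h [Sh Eh]]].
    - exists g; split; [exact Sg | now intros T HT].
    - destruct (smooth_expr_derive a b h Sh) as [_ [h' [Sh' Eh']]].
      exists h'; split; [exact Sh'|].
      intros T HT; simpl.
      rewrite (eq_on_Derive a b _ _ Eh T HT); now apply Eh'. }
  intros [|k] T HT; [exact I|].
  destruct (N k) as [h [Sh Eh]].
  refine (eq_on_ex_derive a b _ h Eh _ T HT).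
  now apply smooth_expr_derive.
Qed.

Lemma smooth_on_plus (a b : R) (g h : R -> R) :
  smooth_on a b g -> smooth_on a b h -> smooth_on a b (fun T => g T + h T).
Proof.
  intros Sg Sh; apply smooth_expr_smooth, smooth_expr_plus;
    now apply smooth_expr_base.
Qed.

Lemma smooth_on_mult (a b : R) (g h : R -> R) :
  smooth_on a b g -> smooth_on a b h -> smooth_on a b (fun T => g T * h T).
Proof.
  intros Sg Sh; apply smooth_expr_smooth, smooth_expr_mult;
    now apply smooth_expr_base.
Qed.

Lemma smooth_on_inv (a b : R) (g : R -> R) :
  smooth_on a b g -> (forall T, a < T < b -> g T <> 0) ->
  smooth_on a b (fun T => / g T).
Proof.
  intros Sg Ng; apply smooth_expr_smooth, smooth_expr_inv; auto.
  now apply smooth_expr_base.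
Qed.

Lemma smooth_on_opp (a b : R) (g : R -> R) :
  smooth_on a b g -> smooth_on a b (fun T => - g T).
Proof. intros Sg k T HT; apply ex_derive_n_opp; now apply Sg. Qed.

Lemma smooth_on_id (a b : R) : smooth_on a b (fun T => T).
Proof.
  intros [|[|k]] T _; simpl; auto.
  - apply @ex_derive_id.
  - apply (ex_derive_ext (Derive_n (fun _ => 1) k)).
    + intros t. change (Derive (Derive_n (fun x => x) k) t)
        with (Derive_n (fun x => x) (S k) t).
      replace (S k) with (k + 1)%nat by lia.
      rewrite <- Derive_n_comp.
      apply Derive_n_ext; intros s; simpl; symmetry; apply Derive_id.
    + apply (ex_derive_n_const 1 (S k)).
Qed.

Lemma smooth_on_pow (a b : R) (g : R -> R) (m : nat) :
  smooth_on a b g -> smooth_on a b (fun T => g T ^ m).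
Proof.
  intros Sg; induction m as [|m IH]; simpl.
  - apply smooth_on_const.
  - now apply smooth_on_mult.
Qed.

Lemma smooth_on_sum (a b : R) (u : R -> nat -> R) (n : nat) :
  (forall k, smooth_on a b (fun T => u T k)) ->
  smooth_on a b (fun T => sum_f_R0 (u T) n).
Proof.
  intros Su; induction n as [|n IH]; simpl; auto.
  now apply smooth_on_plus.
Qed.

Create HintDb smooth.
#[local] Hint Resolve smooth_on_const smooth_on_id smooth_on_plus smooth_on_mult
  smooth_on_opp smooth_on_pow : smooth.

(** * Smoothness of the coefficients of the equation *)

Definition smooth_coefs (a b : R) (u : R -> nat -> R) : Prop :=
  forall n, smooth_on a b (fun T => u T n).

Lemma smooth_coefs_fps_dT (a b : R) (G : nat -> R -> R) (j : nat) :
  (forall n, smooth_on a b (G n)) -> smooth_coefs a b (fps_dT G j).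
Proof. intros SG n; now apply (smooth_on_Derive_n a b (G n) j). Qed.

Lemma smooth_coefs_plus (a b : R) (u v : R -> nat -> R) :
  smooth_coefs a b u -> smooth_coefs a b v ->
  smooth_coefs a b (fun T => PS_plus (u T) (v T)).
Proof.
  intros Su Sv n.
  apply (smooth_on_plus a b (fun T => u T n) (fun T => v T n)); auto.
Qed.

Lemma smooth_coefs_minus (a b : R) (u v : R -> nat -> R) :
  smooth_coefs a b u -> smooth_coefs a b v ->
  smooth_coefs a b (fun T => PS_minus (u T) (v T)).
Proof.
  intros Su Sv n.
  apply (smooth_on_plus a b (fun T => u T n) (fun T => - v T n)); auto.
  now apply (smooth_on_opp a b (fun T => v T n)).
Qed.

Lemma smooth_coefs_scal (a b : R) (c : R -> R) (u : R -> nat -> R) :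
  smooth_on a b c -> smooth_coefs a b u ->
  smooth_coefs a b (fun T => PS_scal (c T) (u T)).
Proof.
  intros Sc Su n.
  apply (smooth_on_mult a b c (fun T => u T n)); auto.
Qed.

Lemma smooth_coefs_mult (a b : R) (u v : R -> nat -> R) :
  smooth_coefs a b u -> smooth_coefs a b v ->
  smooth_coefs a b (fun T => PS_mult (u T) (v T)).
Proof.
  intros Su Sv n.
  apply (smooth_on_sum a b (fun T k => u T k * v T (n - k)%nat)).
  intros k.
  apply (smooth_on_mult a b (fun T => u T k) (fun T => v T (n - k)%nat)); auto.
Qed.

Lemma smooth_coefs_derive (a b : R) (u : R -> nat -> R) :
  smooth_coefs a b u -> smooth_coefs a b (fun T => PS_derive (u T)).
Proof.
  intros Su n.
  apply (smooth_on_mult a b (fun _ => INR (S n)) (fun T => u T (S n)));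
    auto with smooth.
Qed.

Lemma smooth_coefs_incr_1 (a b : R) (u : R -> nat -> R) :
  smooth_coefs a b u -> smooth_coefs a b (fun T => PS_incr_1 (u T)).
Proof.
  intros Su [|n]; [apply (smooth_on_const a b 0) | apply Su].
Qed.

Lemma smooth_coefs_MA_lhs (a b : R) (G : nat -> R -> R) :
  (forall n, smooth_on a b (G n)) -> smooth_coefs a b (MA_lhs G).
Proof.
  intros SG.
  pose proof (fun j => smooth_coefs_fps_dT a b G j SG) as S.
  pose proof (smooth_coefs_derive a b _ (S 0%nat)) as SGf.
  pose proof (smooth_coefs_derive a b _ (S 1%nat)) as SGTf.
  pose proof (smooth_coefs_derive a b _ SGf) as SGff.
  assert (Sc : smooth_on a b (fun T => T * (T ^ 2 - 16)))
    by (unfold Rminus; auto with smooth).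
  assert (Sc' : smooth_on a b (fun T => T ^ 2 + 8 * T - 16))
    by (unfold Rminus; auto with smooth).
  assert (S4 : smooth_on a b (fun T => 4 * T ^ 3)) by auto with smooth.
  exact (smooth_coefs_scal a b _ _ S4
    (smooth_coefs_mult a b _ _ (S 1%nat)
      (smooth_coefs_minus a b _ _
        (smooth_coefs_mult a b _ _
          (smooth_coefs_plus a b _ _ SGf (smooth_coefs_incr_1 a b _ SGff))
          (smooth_coefs_plus a b _ _ (smooth_coefs_scal a b _ _ Sc' (S 1%nat))
            (smooth_coefs_scal a b _ _ Sc (S 2%nat))))
        (smooth_coefs_scal a b _ _ Sc
          (smooth_coefs_incr_1 a b _ (smooth_coefs_mult a b _ _ SGTf SGTf)))))).
Qed.

Lemma smooth_coefs_MA_rhs (a b kappa : R) :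
  smooth_coefs a b (MA_rhs kappa).
Proof. intros [|n]; unfold MA_rhs, fps_const; auto with smooth. Qed.

(** * Dependence of the equation on the last coefficient *)

(** In the [n]-th coefficient of a product, the [n]-th coefficient of a factor
    meets only the constant coefficient of the other one. *)
Lemma PS_mult_diff_r (u u' v v' : nat -> R) (n : nat) :
  (forall k, (k <= n)%nat -> u' k = u k) ->
  (forall k, (k < n)%nat -> v' k = v k) ->
  PS_mult u' v' n - PS_mult u v n = u O * (v' n - v n).
Proof.
  intros Eu Ev; unfold PS_mult.
  destruct n as [|n].
  - simpl; rewrite (Eu O) by lia; ring.
  - rewrite !(decomp_sum _ (S n)) by lia; simpl.
    rewrite (sum_eq (fun i => u' (S i) * v' (n - i)%nat)
                    (fun i => u (S i) * v (n - i)%nat)).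
    + rewrite (Eu O) by lia; ring.
    + intros i Hi; rewrite Eu, Ev by lia; reflexivity.
Qed.

Lemma PS_mult_diff_l (u u' v v' : nat -> R) (n : nat) :
  (forall k, (k < n)%nat -> u' k = u k) ->
  (forall k, (k <= n)%nat -> v' k = v k) ->
  PS_mult u' v' n - PS_mult u v n = v O * (u' n - u n).
Proof.
  intros Eu Ev; unfold PS_mult.
  destruct n as [|n].
  - simpl; rewrite (Ev O) by lia; ring.
  - rewrite !tech5, Nat.sub_diag.
    rewrite (sum_eq (fun i => u' i * v' (S n - i)%nat)
                    (fun i => u i * v (S n - i)%nat)).
    + rewrite (Ev O) by lia; ring.
    + intros i Hi; rewrite Eu, Ev by lia; reflexivity.
Qed.

Lemma PS_mult_agree (u u' v v' : nat -> R) (n : nat) :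
  (forall k, (k <= n)%nat -> u' k = u k) ->
  (forall k, (k <= n)%nat -> v' k = v k) ->
  PS_mult u' v' n = PS_mult u v n.
Proof.
  intros Eu Ev; unfold PS_mult.
  apply sum_eq; intros i Hi; rewrite Eu, Ev by lia; reflexivity.
Qed.

(** [G_f + f G_ff] is the derivative of [f G_f], and the operator [d/df f d/df]
    multiplies [f^(n+1)] by [(n+1)^2] and lowers its degree by one. *)
Lemma coef_Gf_plus_fGff (u : nat -> R) (n : nat) :
  PS_plus (PS_derive u) (PS_incr_1 (PS_derive (PS_derive u))) n =
  INR (S n) ^ 2 * u (S n).
Proof.
  unfold PS_plus, PS_derive, PS_incr_1.
  destruct n as [|n].
  - unfold plus, zero; simpl; ring.
  - unfold plus; simpl AbelianMonoid.plus; rewrite (S_INR (S n));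
    simpl pow; unfold AbelianMonoid.plus; simpl; ring.
Qed.

Definition MA_slope (G0 : R -> R) (n : nat) (T : R) : R :=
  4 * T ^ 3 * Derive G0 T
  * ((T ^ 2 + 8 * T - 16) * Derive G0 T
     + T * (T ^ 2 - 16) * Derive_n G0 2 T)
  * INR (S n) ^ 2.

Lemma MA_lhs_diff (F H : nat -> R -> R) (T : R) (n : nat) :
  (forall j k, (k <= n)%nat -> fps_dT H j T k = fps_dT F j T k) ->
  MA_lhs H T n - MA_lhs F T n =
  MA_slope (F O) n T * (H (S n) T - F (S n) T).
Proof.
  intros E; unfold MA_lhs; cbv zeta.
  set (c := T * (T ^ 2 - 16)).
  set (A := fun G : nat -> R -> R =>
    PS_plus (PS_derive (fps_dT G 0 T))
            (PS_incr_1 (PS_derive (PS_derive (fps_dT G 0 T))))).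
  set (B := fun G : nat -> R -> R =>
    PS_plus (PS_scal (T ^ 2 + 8 * T - 16) (fps_dT G 1 T))
            (PS_scal c (fps_dT G 2 T))).
  set (Q := fun G : nat -> R -> R =>
    PS_incr_1 (PS_mult (PS_derive (fps_dT G 1 T)) (PS_derive (fps_dT G 1 T)))).
  set (X := fun G : nat -> R -> R =>
    PS_minus (PS_mult (A G) (B G)) (PS_scal c (Q G))).
  assert (EA : forall k, A H k - A F k = INR (S k) ^ 2 * (H (S k) T - F (S k) T)).
  { intros k; unfold A; rewrite !coef_Gf_plus_fGff; unfold fps_dT; simpl Derive_n.
    ring. }
  assert (EA0 : forall k, (k < n)%nat -> A H k = A F k).
  { intros k Hk; unfold A; rewrite !coef_Gf_plus_fGff, E by lia; reflexivity. }
  assert (EB : forall k, (k <= n)%nat -> B H k = B F k).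
  { intros k Hk; unfold B, PS_plus, PS_scal; rewrite !E by lia; reflexivity. }
  (* The factor f in front of the square of G_Tf lowers the index, so that the
     unknown coefficient does not enter. *)
  assert (EQ : forall k, (k <= n)%nat -> Q H k = Q F k).
  { intros [|k] Hk; unfold Q, PS_incr_1; [reflexivity|].
    apply PS_mult_agree; intros i Hi; unfold PS_derive; rewrite E by lia;
      reflexivity. }
  assert (EX : forall k, (k <= n)%nat ->
             X H k - X F k = B F O * (A H k - A F k)).
  { intros k Hk.
    rewrite <- (PS_mult_diff_l (A F) (A H) (B F) (B H) k)
      by (intros i Hi; first [apply EA0 | apply EB]; lia).
    unfold X, PS_minus, PS_scal; rewrite EQ by lia.
    unfold plus, opp; simpl; ring. }
  change (4 * T ^ 3 * PS_mult (fps_dT H 1 T) (X H) n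
          - 4 * T ^ 3 * PS_mult (fps_dT F 1 T) (X F) n
          = MA_slope (F O) n T * (H (S n) T - F (S n) T)).
  rewrite <- Rmult_minus_distr_l.
  rewrite (PS_mult_diff_r (fps_dT F 1 T)).
  - rewrite EX, EA by lia.
    change (B F O) with ((T ^ 2 + 8 * T - 16) * Derive (F O) T
                         + c * Derive_n (F O) 2 T).
    change (fps_dT F 1 T O) with (Derive (F O) T).
    unfold MA_slope, c; ring.
  - intros k Hk; apply E; lia.
  - intros k Hk; apply Rminus_diag_uniq; rewrite EX, EA0 by lia; ring.
Qed.

(** * The recursion for the coefficients *)

(** A Newton step for the order-[n] part of the equation, started at [F_(n+1)]. *)
Definition next_term (kappa : R) (G0 : R -> R) (n : nat) (F : nat -> R -> R)
    (T : R) : R :=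
  F (S n) T + (MA_rhs kappa T n + - MA_lhs F T n) * / MA_slope G0 n T.

Section Recursion.

Variables (kappa a b : R) (G0 : R -> R).
Hypotheses (ha : 0 <= a) (hG0 : smooth_on a b G0).
Hypothesis hG0' : forall T : R, a < T < b -> Derive G0 T <> 0.
Hypothesis hG0'' : forall T : R, a < T < b ->
  (T ^ 2 + 8 * T - 16) * Derive G0 T
    + T * (T ^ 2 - 16) * Derive_n G0 2 T <> 0.

Lemma MA_slope_neq_0 (n : nat) (T : R) : a < T < b -> MA_slope G0 n T <> 0.
Proof.
  intros HT; unfold MA_slope.
  assert (INR (S n) ^ 2 <> 0) by (apply pow_nonzero, not_0_INR; lia).
  assert (T ^ 3 <> 0) by (apply pow_nonzero; lra).
  assert (4 <> 0) by lra.
  pose proof (hG0' T HT); pose proof (hG0'' T HT).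
  now repeat (apply Rmult_integral_contrapositive_currified; [|assumption]).
Qed.

Lemma MA_slope_smooth (n : nat) : smooth_on a b (MA_slope G0 n).
Proof.
  pose proof (smooth_on_Derive_n a b G0 1 hG0) as S1.
  pose proof (smooth_on_Derive_n a b G0 2 hG0) as S2.
  unfold MA_slope, Rminus; auto 12 with smooth.
Qed.

Lemma next_term_smooth (n : nat) (F : nat -> R -> R) :
  (forall k, smooth_on a b (F k)) -> smooth_on a b (next_term kappa G0 n F).
Proof.
  intros SF; unfold next_term.
  pose proof (smooth_coefs_MA_lhs a b F SF n) as SL.
  pose proof (smooth_coefs_MA_rhs a b kappa n) as SR.
  pose proof (smooth_on_inv a b _ (MA_slope_smooth n) (MA_slope_neq_0 n)) as SI.
  auto 8 with smooth.
Qed.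

Lemma MA_order_iff_next_term (n : nat) (F H : nat -> R -> R) :
  eq_on a b (F O) G0 ->
  (forall k, (k <= n)%nat -> eq_on a b (H k) (F k)) ->
  MA_order kappa a b H n <-> eq_on a b (H (S n)) (next_term kappa G0 n F).
Proof.
  intros EF EH.
  assert (D : forall T, a < T < b ->
    MA_lhs H T n - MA_lhs F T n = MA_slope G0 n T * (H (S n) T - F (S n) T)).
  { intros T HT; rewrite (MA_lhs_diff F H T n).
    - unfold MA_slope.
      rewrite (eq_on_Derive a b _ _ EF T HT), (eq_on_Derive_n a b _ _ 2 EF T HT).
      reflexivity.
    - intros j k Hk; now apply (eq_on_Derive_n a b (H k) (F k)); [apply EH|]. }
  split; intros E T HT; specialize (D T HT); specialize (E T HT);
    pose proof (MA_slope_neq_0 n T HT) as N.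
  - unfold next_term; rewrite <- E.
    replace (MA_lhs H T n + - MA_lhs F T n)
      with (MA_slope G0 n T * (H (S n) T - F (S n) T)) by (rewrite <- D; ring).
    field; exact N.
  - unfold next_term in E; rewrite E in D.
    replace (MA_lhs H T n) with (MA_lhs F T n + (MA_lhs H T n - MA_lhs F T n))
      by ring.
    rewrite D; field; exact N.
Qed.

(** A step of the recursion needs a whole series, of which only the terms of index
    at most [n] matter at stage [n]; starting from the constant family [G0] makes
    the later, provisional terms smooth as well. *)
Fixpoint solution_upto (n : nat) : nat -> R -> R :=
  match n with
  | O => fun _ => G0
  | S m => fun k =>
      if Nat.leb k m then solution_upto m k
      else next_term kappa G0 m (solution_upto m)
  end.

Definition solution (n : nat) : R -> R := solution_upto n n.

Lemma solution_upto_stable (n k : nat) :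
  (k <= n)%nat -> solution_upto n k = solution k.
Proof.
  induction n as [|n IH]; intros Hk.
  - replace k with O by lia; reflexivity.
  - destruct (Nat.eq_dec k (S n)) as [->|Hne]; [reflexivity|].
    simpl; rewrite (proj2 (Nat.leb_le k n)) by lia.
    apply IH; lia.
Qed.

Lemma solution_S (n : nat) :
  solution (S n) = next_term kappa G0 n (solution_upto n).
Proof.
  unfold solution; cbn [solution_upto].
  now rewrite (proj2 (Nat.leb_gt (S n) n)) by lia.
Qed.

Lemma solution_upto_smooth (n k : nat) : smooth_on a b (solution_upto n k).
Proof.
  revert k; induction n as [|n IH]; intros k; simpl; auto.
  destruct (Nat.leb k n); auto.
  now apply next_term_smooth.
Qed.

Lemma solution_formal_solution : formal_solution kappa a b G0 solution.
Proof.
  split; [split|].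
  - intros T _; reflexivity.
  - intros n; apply solution_upto_smooth.
  - intros n; apply (MA_order_iff_next_term n (solution_upto n)).
    + rewrite solution_upto_stable by lia; intros T _; reflexivity.
    + intros k Hk; rewrite solution_upto_stable by exact Hk; now intros T HT.
    + rewrite solution_S; now intros T HT.
Qed.

Lemma formal_solution_unique (G H : nat -> R -> R) :
  formal_solution kappa a b G0 G -> formal_solution kappa a b G0 H ->
  forall n, eq_on a b (H n) (G n).
Proof.
  intros [[G00 _] EG] [[H00 _] EH].
  assert (U : forall n k, (k <= n)%nat -> eq_on a b (H k) (G k)).
  { induction n as [|n IH]; intros k Hk T HT.
    - replace k with O by lia; rewrite H00, G00; auto.
    - destruct (Nat.eq_dec k (S n)) as [->|Hne]; [|apply IH; auto; lia].
      transitivity (next_term kappa G0 n G T).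
      + now apply (MA_order_iff_next_term n G H G00 IH).
      + symmetry; refine (proj1 (MA_order_iff_next_term n G G G00 _) (EG n) T HT).
        now intros i Hi t Ht. }
  intros n; now apply (U n n).
Qed.

End Recursion.

Theorem mainTheorem6
  (kappa : R) (hkappa : kappa <> 0)
  (a b : R) (ha : 0 <= a) (hab : a < b) (hb : b <= 4)
  (G0 : R -> R) (hG0 : smooth_on a b G0)
  (hG0' : forall T : R, a < T < b -> Derive G0 T <> 0)
  (hG0'' : forall T : R, a < T < b ->
     (T ^ 2 + 8 * T - 16) * Derive G0 T
       + T * (T ^ 2 - 16) * Derive_n G0 2 T <> 0) :
  (exists G : nat -> R -> R,
     formal_solution kappa a b G0 G /\
     forall H : nat -> R -> R,
       formal_solution kappa a b G0 H -> forall n : nat, eq_on a b (H n) (G n))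
  /\
  (* The terms of index at most n of a series starting at G0 determine the next
     one: the order-n part of the equation holds iff that term is g. *)
  (forall (n : nat) (F : nat -> R -> R),
     smooth_series_from a b G0 F ->
     exists g : R -> R,
       smooth_on a b g /\
       forall H : nat -> R -> R,
         smooth_series_from a b G0 H ->
         (forall k : nat, (k <= n)%nat -> eq_on a b (H k) (F k)) ->
         (MA_order kappa a b H n <-> eq_on a b (H (S n)) g)).
Proof.
  split.
  - assert (SG : formal_solution kappa a b G0 (solution kappa G0))
      by now apply solution_formal_solution.
    exists (solution kappa G0); split; [exact SG|].
    intros H SH; now apply (formal_solution_unique kappa a b G0).
  - intros n F [F0 SF].
    exists (next_term kappa G0 n F); split.
    + now apply next_term_smooth.
    + intros H _ EH; now apply MA_order_iff_next_term.
Qed.
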